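(* Let $f\in C^\infty(\mathbb{R})$ be a function without zeros, let $(D,g^D)$ be the associated warped product distribution on $\mathbb{R}\times H_3$ (see context), and let $\lambda_0\in\mathbb{R}$. Then $(D,g^D)$ is a distribution with constant scalar curvature $\lambda_0$ if and only if one of the following holds, where $c_1,c_2$ are constants: (1) $\lambda_0=0$ and $f(t)=(c_2t+c_1)^{\frac23}$; (2) $\lambda_0>0$ and $f(t)=\left(c_1e^{\sqrt{\frac{3\lambda_0}{8}}\,t}+c_2e^{-\sqrt{\frac{3\lambda_0}{8}}\,t}\right)^{\frac23}$; (3) $\lambda_0<0$ and $f(t)=\left(c_1\cos\left(\sqrt{-\tfrac{3\lambda_0}{8}}\,t\right)+c_2\sin\left(\sqrt{-\tfrac{3\lambda_0}{8}}\,t\right)\right)^{\frac23}$.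
   Context: $H_3$ is the Heisenberg group: $\mathbb{R}^3$ with coordinates $(x,y,z)$ and Riemannian metric $g_{H_3}=dx^2+dy^2+(dz+\frac12(y\,dx-x\,dy))^2$, with orthonormal frame $e_1=\partial_x-\frac y2\partial_z$, $e_2=\partial_y+\frac x2\partial_z$, $e_3=\partial_z$, satisfying $[e_1,e_2]=e_3$, $[e_1,e_3]=[e_2,e_3]=0$. Let $D^1=\mathrm{span}\{e_1,e_2\}$ and let $D^{1,\bot}=\mathrm{span}\{e_3\}$ be its orthogonal complement in $TH_3$, with induced metrics $g^{D^1},g^{D^{1,\bot}}$. On $M=\mathbb{R}\times H_3$ with projections $\pi_1,\pi_2$ onto the factors, and $t$ the coordinate on $\mathbb{R}$, put $$g^M_f=\pi_1^*dt^2\oplus f^2\pi_2^*g^{D^1}\oplus\pi_2^*g^{D^{1,\bot}},\quad D=\pi_1^*(T\mathbb{R})\oplus\pi_2^*D^1=\mathrm{span}\{\partial_t,e_1,e_2\},\quad g^D=\pi_1^*dt^2\oplus f^2\pi_2^*g^{D^1}.$$ $(D,g^D)$ is called the warped product distribution on $M$. Let $\nabla^f$ be the Levi-Civita connection of $g^M_f$, $D^\bot$ the orthogonal complement of $D$ in $TM$, $\pi^D$ and $\pi^{D^\bot}$ the orthogonal projections, $[X,Y]^D=\pi^D[X,Y]$, $[X,Y]^{D^\bot}=\pi^{D^\bot}[X,Y]$. For sections $X,Y,Z$ of $D$, set $\nabla^D_XY=\pi^D(\nabla^f_XY)$ and $$R^D(X,Y)Z=\nabla^D_X\nabla^D_YZ-\nabla^D_Y\nabla^D_XZ-\nabla^D_{[X,Y]^D}Z-\pi^D[[X,Y]^{D^\bot},Z].$$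 The Ricci tensor is $\mathrm{Ric}^D(X,Y)=\sum_{k=1}^3g^D(R^D(X,E_k)Y,E_k)$ for an orthonormal basis $E_1,E_2,E_3$ of $(D,g^D)$ (note this sign convention). The scalar curvature is $s^D=\sum_{k=1}^3\mathrm{Ric}^D(E_k,E_k)$, e.g. with $E_1=\partial_t$, $E_2=f^{-1}e_1$, $E_3=f^{-1}e_2$; constant scalar curvature $\lambda_0$ means $s^D=\lambda_0$ identically.
   Formalization: The formulas for f are corrected by a global sign, f = ±(…)^{2/3} with real c1, c2: as stated the claim fails for f = −1, λ0 = 0, since the metric depends only on f² while a real 2/3 power is nonnegative; for f > 0 it is the original claim. *)

(* Defs.v *)
From Stdlib Require Import Reals.
From Coquelicot Require Import Coquelicot.
Open Scope R_scope.

Definition H3 : Type := (R * R * R)%type.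
Definition M : Type := (R * H3)%type.

(** Points in the global chart [(t, (x, y, z))], and tangent vectors written in the coordinate basis
    [d/dt, d/dx, d/dy, d/dz], share the type [M] (resp. [H3]). *)
Definition vfield : Type := M -> M.

Definition vadd (u v : M) : M := plus u v.
Definition vsub (u v : M) : M := minus u v.
Definition vscal (a : R) (u : M) : M := scal a u.

Inductive coord : Set := ct | cx | cy | cz.

Definition get (i : coord) (p : M) : R :=
  let '(t, (x, y, z)) := p in
  match i with ct => t | cx => x | cy => y | cz => z end.

Definition set (i : coord) (p : M) (s : R) : M :=
  let '(t, (x, y, z)) := p in
  match i with
  | ct => (s, (x, y, z))
  | cx => (t, (s, y, z))
  | cy => (t, (x, s, z))
  | cz => (t, (x, y, s))
  end.

Definition of_coords (F : coord -> R) : M := (F ct, (F cx, F cy, F cz)).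

Definition ex_partial (i : coord) (h : M -> R) (p : M) : Prop :=
  ex_derive (fun s => h (set i p s)) (get i p).

Definition partial (i : coord) (h : M -> R) (p : M) : R :=
  Derive (fun s => h (set i p s)) (get i p).

Fixpoint is_Ck (n : nat) (h : M -> R) : Prop :=
  match n with
  | O => forall p, continuous h p
  | S m => (forall p, continuous h p) /\
           forall i, (forall p, ex_partial i h p) /\ is_Ck m (partial i h)
  end.

Definition smooth (h : M -> R) : Prop := forall n, is_Ck n h.

Definition smooth_vfield (X : vfield) : Prop :=
  forall i, smooth (fun p => get i (X p)).

Definition smooth_R (f : R -> R) : Prop := forall n t, ex_derive_n f n t.

(** The derivative [X h] of a function along a vector field. *)
Definition deriv (X : vfield) (h : M -> R) (p : M) : R :=
  get ct (X p) * partial ct h p + get cx (X p) * partial cx h p +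
  get cy (X p) * partial cy h p + get cz (X p) * partial cz h p.

Definition bracket (X Y : vfield) : vfield := fun p =>
  of_coords (fun i => deriv X (fun q => get i (Y q)) p -
                      deriv Y (fun q => get i (X q)) p).

Definition metric : Type := M -> M -> M -> R.

Record is_levi_civita (g : metric) (nabla : vfield -> vfield -> vfield) : Prop := {
  lc_smooth : forall X Y, smooth_vfield X -> smooth_vfield Y ->
    smooth_vfield (nabla X Y);
  lc_add_l : forall X1 X2 Y,
    smooth_vfield X1 -> smooth_vfield X2 -> smooth_vfield Y ->
    forall p, nabla (fun q => vadd (X1 q) (X2 q)) Y p =
              vadd (nabla X1 Y p) (nabla X2 Y p);
  lc_scal_l : forall h X Y, smooth h -> smooth_vfield X -> smooth_vfield Y ->
    forall p, nabla (fun q => vscal (h q) (X q)) Y p = vscal (h p) (nabla X Y p);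
  lc_add_r : forall X Y1 Y2,
    smooth_vfield X -> smooth_vfield Y1 -> smooth_vfield Y2 ->
    forall p, nabla X (fun q => vadd (Y1 q) (Y2 q)) p =
              vadd (nabla X Y1 p) (nabla X Y2 p);
  lc_leibniz : forall h X Y, smooth h -> smooth_vfield X -> smooth_vfield Y ->
    forall p, nabla X (fun q => vscal (h q) (Y q)) p =
              vadd (vscal (deriv X h p) (Y p)) (vscal (h p) (nabla X Y p));
  lc_torsion_free : forall X Y, smooth_vfield X -> smooth_vfield Y ->
    forall p, vsub (nabla X Y p) (nabla Y X p) = bracket X Y p;
  lc_metric : forall X Y Z,
    smooth_vfield X -> smooth_vfield Y -> smooth_vfield Z ->
    forall p, deriv X (fun q => g q (Y q) (Z q)) p =
              g p (nabla X Y p) (Z p) + g p (Y p) (nabla X Z p)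
}.

(** [dx^2 + dy^2 + (dz + (y dx - x dy) / 2)^2], polarized. *)
Definition gH3 (q u v : H3) : R :=
  let '(x, y, z) := q in
  let '(u1, u2, u3) := u in
  let '(v1, v2, v3) := v in
  u1 * v1 + u2 * v2 +
  (u3 + / 2 * (y * u1 - x * u2)) * (v3 + / 2 * (y * v1 - x * v2)).

Definition e1 (q : H3) : H3 := let '(x, y, z) := q in (1, 0, - (y / 2)).
Definition e2 (q : H3) : H3 := let '(x, y, z) := q in (0, 1, x / 2).
Definition e3 (q : H3) : H3 := (0, 0, 1).

(** Orthogonal projections of [T H3] onto [D1 = span{e1, e2}] and onto its
    orthogonal complement [span{e3}]. *)
Definition projD1 (q u : H3) : H3 :=
  plus (scal (gH3 q u (e1 q)) (e1 q)) (scal (gH3 q u (e2 q)) (e2 q)).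
Definition projD1perp (q u : H3) : H3 := scal (gH3 q u (e3 q)) (e3 q).

(** The metrics induced by [gH3], as forms on [T H3] vanishing on the other summand. *)
Definition gD1 (q u v : H3) : R := gH3 q (projD1 q u) (projD1 q v).
Definition gD1perp (q u v : H3) : R := gH3 q (projD1perp q u) (projD1perp q v).

(** On vectors outside [D], [gD f] ignores the component along [e3]. *)
Definition gD (f : R -> R) : metric := fun p u v =>
  fst u * fst v + f (fst p) ^ 2 * gD1 (snd p) (snd u) (snd v).

Definition gM (f : R -> R) : metric := fun p u v =>
  gD f p u v + gD1perp (snd p) (snd u) (snd v).

(** The orthonormal frame [d/dt, e1 / f, e2 / f] of [(D, gD f)]. *)
Definition ED1 : vfield := fun p => (1, (0, 0, 0)).
Definition ED2 (f : R -> R) : vfield := fun p => (0, scal (/ f (fst p)) (e1 (snd p))).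
Definition ED3 (f : R -> R) : vfield := fun p => (0, scal (/ f (fst p)) (e2 (snd p))).

(** Orthogonal projections of [TM] onto [D] and onto its orthogonal complement
    for [gM f]. *)
Definition piD (f : R -> R) (X : vfield) : vfield := fun p =>
  vadd (vadd (vscal (gM f p (X p) (ED1 p)) (ED1 p))
             (vscal (gM f p (X p) (ED2 f p)) (ED2 f p)))
       (vscal (gM f p (X p) (ED3 f p)) (ED3 f p)).
Definition piDperp (f : R -> R) (X : vfield) : vfield := fun p =>
  vsub (X p) (piD f X p).

Definition nablaD (f : R -> R) (nabla : vfield -> vfield -> vfield)
    (X Y : vfield) : vfield :=
  piD f (nabla X Y).

Definition curvD (f : R -> R) (nabla : vfield -> vfield -> vfield)
    (X Y Z : vfield) : vfield := fun p =>
  vsub (vsub (vsub (nablaD f nabla X (nablaD f nabla Y Z) p)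
                   (nablaD f nabla Y (nablaD f nabla X Z) p))
             (nablaD f nabla (piD f (bracket X Y)) Z p))
       (piD f (bracket (piDperp f (bracket X Y)) Z) p).

(** The argument order makes this the negative of the usual Ricci tensor. *)
Definition RicD (f : R -> R) (nabla : vfield -> vfield -> vfield)
    (X Y : vfield) (p : M) : R :=
  gD f p (curvD f nabla X ED1 Y p) (ED1 p) +
  gD f p (curvD f nabla X (ED2 f) Y p) (ED2 f p) +
  gD f p (curvD f nabla X (ED3 f) Y p) (ED3 f p).

Definition scalar_curvD (f : R -> R) (nabla : vfield -> vfield -> vfield)
    (p : M) : R :=
  RicD f nabla ED1 ED1 p + RicD f nabla (ED2 f) (ED2 f) p +
  RicD f nabla (ED3 f) (ED3 f) p.

Definition constant_scalar_curvature (f : R -> R)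
    (nabla : vfield -> vfield -> vfield) (l : R) : Prop :=
  forall p, scalar_curvD f nabla p = l.

(** [w ^ (2/3)] for every real [w], i.e. the square of the real cube root.
    [Rpower] alone is wrong off the positive reals ([Rpower 0 a = 1]).
    It is nonnegative, while [gM f] does not see the sign of [f]: a zero-free [f]
    of either sign is therefore described up to a global sign. *)
Definition pow23 (w : R) : R :=
  if Req_EM_T w 0 then 0 else Rpower (Rabs w) (2 / 3).

(* Main.v *)
Require Import Defs.
From Stdlib Require Import Reals Lra FunctionalExtensionality.
From Coquelicot Require Import Coquelicot.
Open Scope R_scope.

(** Let [r = f' / f] be the logarithmic derivative of the warping function.

    Geometry.  Take the orthonormal frame [T = d/dt], [E1 = e1 / f], [E2 = e2 / f] of
    the distribution.  The bracket of [T] and [Ei] is [- r Ei], that of [E1] and [E2]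
    is [f^-2 e3].  The latter is orthogonal to the distribution, so the Koszul
    formula, applied to an orthonormal frame, gives the projected connection: the
    derivative of [Ei] along [Ei] is [- r T], that of [T] along [Ei] is [r Ei], and
    all others vanish ([nablaD_frame]).  The vertical field [f^-2 e3] enters the
    curvature only through its brackets with the frame, which are again vertical
    and project to zero ([piD_bracket_vert]).  Each of the two planes spanned by [T]
    and an [Ei] then contributes [r' + r^2], the plane of [E1] and [E2] contributes
    [r^2], and every plane is counted twice: [s^D = 4 r' + 6 r^2]
    ([scalar_curvD_warped]).

    Analysis.  The substitution [f^3 = sigma w^2], with [sigma] the sign of [f],
    linearizes this expression: [r = (2/3) w' / w], hence [4 r' + 6 r^2 = (8/3) w'' / w].
    Constant scalar curvature [lambda0] therefore means [w'' = (3 lambda0 / 8) w]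
    ([scalar_of_profile] and [profile_of_scalar]).  This linear equation is
    solved by exhibiting first integrals ([ode_zero], [ode_exp], [ode_trig]), and
    [f] is recovered as [sigma w^(2/3)], since for nonzero [w] the only positive
    number whose cube is [w^2] is [pow23 w]. *)

(** * Smooth functions on the chart *)

Lemma set_get (i : coord) (p : M) : set i p (get i p) = p.
Proof. now destruct p as [t [[x y] z]], i. Qed.

Lemma is_Ck_lower (n : nat) : forall h, is_Ck (S n) h -> is_Ck n h.
Proof.
  induction n as [|n IH]; intros h [hc hd]; [exact hc|].
  split; [exact hc|]. intros i; destruct (hd i) as [he hp]; split; auto.
Qed.

Lemma is_Ck_const (n : nat) : forall c, is_Ck n (fun _ => c).
Proof.
  induction n as [|n IH]; intros c; simpl; [intro; apply continuous_const|].
  split; [intro; apply continuous_const|]. intros i; split.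
  - intros p; apply (ex_derive_const c (get i p)).
  - replace (partial i (fun _ => c)) with (fun _ : M => 0); [apply IH|].
    extensionality p; symmetry; exact (Derive_const c (get i p)).
Qed.

Lemma is_Ck_plus (n : nat) : forall g h, is_Ck n g -> is_Ck n h ->
  is_Ck n (fun p => g p + h p).
Proof.
  induction n as [|n IH]; intros g h hg hh; simpl.
  - intros p; apply (continuous_plus g h); auto.
  - destruct hg as [gc gd], hh as [hc hd]; split.
    + intros p; apply (continuous_plus g h); auto.
    + intros i; destruct (gd i) as [ge gp], (hd i) as [he hp]; split.
      * intros p; apply (ex_derive_plus (fun s => g (set i p s)) (fun s => h (set i p s)));
          [apply ge | apply he].
      * replace (partial i (fun p => g p + h p))
          with (fun p => partial i g p + partial i h p); [now apply IH|].
        extensionality p; symmetry.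
        apply (Derive_plus (fun s => g (set i p s)) (fun s => h (set i p s)));
          [apply ge | apply he].
Qed.

(** The Leibniz rule expresses a partial derivative of a product through products
    of functions that are one order less smooth; the factors that are not
    differentiated still have to be lowered by one order. *)
Lemma is_Ck_mult (n : nat) : forall g h, is_Ck n g -> is_Ck n h ->
  is_Ck n (fun p => g p * h p).
Proof.
  induction n as [|n IH]; intros g h hg hh.
  - intros p; apply (continuous_mult g h); auto.
  - assert (hg' := is_Ck_lower _ _ hg); assert (hh' := is_Ck_lower _ _ hh).
    destruct hg as [gc gd], hh as [hc hd]; split.
    + intros p; apply (continuous_mult g h); auto.
    + intros i; destruct (gd i) as [ge gp], (hd i) as [he hp]; split.
      * intros p; apply (ex_derive_mult (fun s => g (set i p s)) (fun s => h (set i p s)));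
          [apply ge | apply he].
      * replace (partial i (fun p => g p * h p))
          with (fun p => partial i g p * h p + g p * partial i h p);
          [apply is_Ck_plus; now apply IH|].
        extensionality p; symmetry; unfold partial at 1.
        rewrite Derive_mult; [now rewrite set_get | apply ge | apply he].
Qed.

Lemma smooth_const (c : R) : smooth (fun _ => c).
Proof. intro n; apply is_Ck_const. Qed.

Lemma smooth_mult (g h : M -> R) : smooth g -> smooth h -> smooth (fun p => g p * h p).
Proof. intros hg hh n; now apply is_Ck_mult. Qed.

(** The derivative [- h' / h^2] of [1 / h] involves [1 / h] itself to one order
    less, so that the order can be raised by induction. *)
Lemma smooth_inv (h : M -> R) :
  smooth h -> (forall p, h p <> 0) -> smooth (fun p => / h p).
Proof.
  intros hh h0 n.
  assert (c : forall p, continuous (fun p => / h p) p).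
  { intros p; apply (continuous_comp h Rinv); [apply (hh O)|].
    apply continuity_pt_filterlim, (continuity_pt_inv (fun x => x));
      [apply derivable_continuous, derivable_id | apply h0]. }
  induction n as [|n IH]; [exact c|].
  split; [exact c|]. intros i.
  destruct (hh (S n)) as [_ hd]; destruct (hd i) as [he hp]; split.
  - intros p; apply (ex_derive_inv (fun s => h (set i p s))); [apply he | apply h0].
  - replace (partial i (fun p => / h p))
      with (fun p => (-1 * partial i h p) * (/ h p * / h p)).
    { repeat apply is_Ck_mult; auto; apply is_Ck_const. }
    extensionality p; symmetry; unfold partial at 1.
    rewrite Derive_inv; [|apply he | apply h0].
    rewrite set_get; fold (partial i h p); field; apply h0.
Qed.

Lemma smooth_R_Derive (g : R -> R) : smooth_R g -> smooth_R (Derive g).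
Proof.
  intros hg n t. destruct n as [|n]; [exact I|].
  apply (ex_derive_ext (Derive_n g (S n))); [|exact (hg (S (S n)) t)].
  intros s; rewrite <- (Nat.add_1_r n), <- Derive_n_comp; reflexivity.
Qed.

Lemma smooth_R_ex_derive (g : R -> R) (t : R) : smooth_R g -> ex_derive g t.
Proof. intros hg; exact (hg 1%nat t). Qed.

Lemma partial_time (g : R -> R) (i : coord) (p : M) :
  partial i (fun q => g (fst q)) p =
  match i with ct => Derive g (fst p) | _ => 0 end.
Proof.
  destruct p as [t [[x y] z]], i; [reflexivity| | |]; apply (Derive_const (g t)).
Qed.

Lemma smooth_time (g : R -> R) : smooth_R g -> smooth (fun p => g (fst p)).
Proof.
  intros hg n; revert g hg.
  induction n as [|n IH]; intros g hg.
  all: assert (c : forall p : M, continuous (fun p : M => g (fst p)) p)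
    by (intros p; apply (continuous_comp (fun p : M => fst p) g);
        [apply continuous_fst | now apply (ex_derive_continuous g), smooth_R_ex_derive]).
  - exact c.
  - split; [exact c|]. intros i; split.
    + intros [t [[x y] z]]; destruct i; [now apply smooth_R_ex_derive| | |];
        apply (ex_derive_const (g t)).
    + replace (partial i (fun q => g (fst q)))
        with (fun p : M => match i with ct => Derive g (fst p) | _ => 0 end)
        by (extensionality p; symmetry; apply partial_time).
      destruct i; [now apply IH, smooth_R_Derive| | |]; apply is_Ck_const.
Qed.

Lemma partial_coord (i j : coord) (p : M) :
  partial j (get i) p =
  match i, j with ct, ct | cx, cx | cy, cy | cz, cz => 1 | _, _ => 0 end.
Proof.
  destruct p as [t [[x y] z]], i, j; apply is_derive_unique; simpl;
    (auto_derive; [exact I | reflexivity]).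
Qed.

Lemma smooth_coord (i : coord) : smooth (get i).
Proof.
  assert (c : forall p, continuous (get i) p).
  { assert (c1 : forall (U V : UniformSpace) (F : M -> prod_UniformSpace U V) p,
        continuous F p -> continuous (fun q => fst (F q)) p)
      by (intros U V F p h; apply (continuous_comp F fst); [exact h | apply continuous_fst]).
    assert (c2 : forall (U V : UniformSpace) (F : M -> prod_UniformSpace U V) p,
        continuous F p -> continuous (fun q => snd (F q)) p)
      by (intros U V F p h; apply (continuous_comp F snd); [exact h | apply continuous_snd]).
    intros p.
    apply (continuous_ext (fun p : M =>
      match i with
      | ct => fst p
      | cx => fst (fst (snd p))
      | cy => snd (fst (snd p))
      | cz => snd (snd p)
      end)); [now intros [t [[x y] z]]; destruct i|].
    destruct i; repeat first [apply c1 | apply c2]; apply continuous_id. }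
  intros [|n]; [exact c|]. split; [exact c|]. intros j; split.
  - intros [t [[x y] z]]; destruct i, j; unfold ex_partial; simpl; now auto_derive.
  - replace (partial j (get i)) with
      (fun _ : M => match i, j with ct, ct | cx, cx | cy, cy | cz, cz => 1 | _, _ => 0 end);
      [apply is_Ck_const|].
    extensionality p; symmetry; apply partial_coord.
Qed.

Lemma smooth_ex_partial (h : M -> R) (i : coord) (p : M) : smooth h -> ex_partial i h p.
Proof. intros hs; destruct (hs 1%nat) as [_ hd]; apply hd. Qed.

(** * Derivations and coordinates of vector fields *)

Lemma deriv_const (X : vfield) (c : R) (p : M) : deriv X (fun _ => c) p = 0.
Proof.
  unfold deriv, partial; rewrite !Derive_const; ring.
Qed.

Lemma deriv_mult (X : vfield) (g h : M -> R) (p : M) : smooth g -> smooth h ->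
  deriv X (fun q => g q * h q) p = deriv X g p * h p + g p * deriv X h p.
Proof.
  intros hg hh; unfold deriv, partial.
  rewrite !Derive_mult by (apply smooth_ex_partial; assumption).
  rewrite !set_get; ring.
Qed.

Lemma deriv_time (X : vfield) (g : R -> R) (p : M) :
  deriv X (fun q => g (fst q)) p = get ct (X p) * Derive g (fst p).
Proof. unfold deriv; rewrite !partial_time; ring. Qed.

Lemma deriv_coord (X : vfield) (i : coord) (p : M) : deriv X (get i) p = get i (X p).
Proof.
  unfold deriv; rewrite !partial_coord; destruct i; ring.
Qed.

Lemma coords_ext (u v : M) : (forall i, get i u = get i v) -> u = v.
Proof.
  destruct u as [a [[b c] d]], v as [a' [[b' c'] d']]; intros h.
  repeat f_equal; [apply (h ct) | apply (h cx) | apply (h cy) | apply (h cz)].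
Qed.

Lemma get_vadd (i : coord) (u v : M) : get i (vadd u v) = get i u + get i v.
Proof. now destruct u as [a [[b c] d]], v as [a' [[b' c'] d']], i. Qed.

Lemma get_vsub (i : coord) (u v : M) : get i (vsub u v) = get i u - get i v.
Proof. now destruct u as [a [[b c] d]], v as [a' [[b' c'] d']], i. Qed.

Lemma get_vscal (i : coord) (r : R) (u : M) : get i (vscal r u) = r * get i u.
Proof. now destruct u as [a [[b c] d]], i. Qed.

Lemma get_of_coords (i : coord) (F : coord -> R) : get i (of_coords F) = F i.
Proof. now destruct i. Qed.

(** * The orthonormal frame and the projection onto D *)

Inductive leg : Set := legT | leg1 | leg2.

Definition frame (f : R -> R) (l : leg) : vfield :=
  match l with legT => ED1 | leg1 => ED2 f | leg2 => ED3 f end.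

Lemma frame_coord (f : R -> R) (l : leg) (i : coord) :
  (fun p => get i (frame f l p)) =
  match l, i with
  | legT, ct => fun _ => 1
  | leg1, cx | leg2, cy => fun p => / f (fst p)
  | leg1, cz => fun p => - / 2 * get cy p * / f (fst p)
  | leg2, cz => fun p => / 2 * get cx p * / f (fst p)
  | _, _ => fun _ => 0
  end.
Proof.
  extensionality p; destruct p as [t [[x y] z]], l, i;
    cbn; unfold mult; simpl; try reflexivity; unfold Rdiv; ring.
Qed.

Lemma get_frame (f : R -> R) (l : leg) (i : coord) (p : M) :
  get i (frame f l p) =
  match l, i with
  | legT, ct => 1
  | leg1, cx | leg2, cy => / f (fst p)
  | leg1, cz => - / 2 * get cy p * / f (fst p)
  | leg2, cz => / 2 * get cx p * / f (fst p)
  | _, _ => 0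
  end.
Proof.
  assert (h := f_equal (fun F => F p) (frame_coord f l i)).
  simpl in h; rewrite h; now destruct l, i.
Qed.

Lemma smooth_inv_time (f : R -> R) : smooth_R f -> (forall t, f t <> 0) ->
  smooth (fun p => / f (fst p)).
Proof. intros fs f0; apply (smooth_inv (fun p => f (fst p))); auto using smooth_time. Qed.

Lemma smooth_frame (f : R -> R) (l : leg) :
  smooth_R f -> (forall t, f t <> 0) -> smooth_vfield (frame f l).
Proof.
  intros fs f0 i.
  assert (s : smooth (fun p => / f (fst p)))
    by (apply smooth_inv; [now apply smooth_time | auto]).
  rewrite frame_coord; destruct l, i; repeat apply smooth_mult;
    auto using smooth_const, smooth_coord.
Qed.

(** In these coordinates the vertical component of [u] is [u_z + (y u_x - x u_y) / 2]:
    the contact form of the Heisenberg group. *)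
Lemma gM_get (f : R -> R) (p u v : M) :
  gM f p u v =
  get ct u * get ct v + f (fst p) ^ 2 * (get cx u * get cx v + get cy u * get cy v) +
  (get cz u + / 2 * (get cy p * get cx u - get cx p * get cy u)) *
  (get cz v + / 2 * (get cy p * get cx v - get cx p * get cy v)).
Proof.
  destruct p as [t [[x y] z]], u as [a [[b c] d]], v as [a' [[b' c'] d']].
  unfold gM, gD, gD1, gD1perp, projD1, projD1perp, scal; cbn; unfold mult; cbn; field.
Qed.

Lemma gD_get (f : R -> R) (p u v : M) :
  gD f p u v =
  get ct u * get ct v + f (fst p) ^ 2 * (get cx u * get cx v + get cy u * get cy v).
Proof.
  destruct p as [t [[x y] z]], u as [a [[b c] d]], v as [a' [[b' c'] d']].
  unfold gM, gD, gD1, gD1perp, projD1, projD1perp, scal; cbn; unfold mult; cbn; field.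
Qed.

Lemma gM_vadd_l (f : R -> R) (p u v w : M) : gM f p (vadd u v) w = gM f p u w + gM f p v w.
Proof. rewrite !gM_get, !get_vadd; ring. Qed.

Lemma gM_vsub_l (f : R -> R) (p u v w : M) : gM f p (vsub u v) w = gM f p u w - gM f p v w.
Proof. rewrite !gM_get, !get_vsub; ring. Qed.

Lemma gM_vscal_l (f : R -> R) (p : M) (a : R) (u w : M) :
  gM f p (vscal a u) w = a * gM f p u w.
Proof. rewrite !gM_get, !get_vscal; ring. Qed.

Lemma gM_sym (f : R -> R) (p u v : M) : gM f p u v = gM f p v u.
Proof. rewrite !gM_get; ring. Qed.

Lemma gD_vadd_l (f : R -> R) (p u v w : M) : gD f p (vadd u v) w = gD f p u w + gD f p v w.
Proof. rewrite !gD_get, !get_vadd; ring. Qed.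

Lemma gD_vsub_l (f : R -> R) (p u v w : M) : gD f p (vsub u v) w = gD f p u w - gD f p v w.
Proof. rewrite !gD_get, !get_vsub; ring. Qed.

Lemma gD_vscal_l (f : R -> R) (p : M) (a : R) (u w : M) :
  gD f p (vscal a u) w = a * gD f p u w.
Proof. rewrite !gD_get, !get_vscal; ring. Qed.

Definition delta (i j : leg) : R :=
  match i, j with legT, legT | leg1, leg1 | leg2, leg2 => 1 | _, _ => 0 end.

Lemma gM_frame (f : R -> R) (i j : leg) (p : M) : f (fst p) <> 0 ->
  gM f p (frame f i p) (frame f j p) = delta i j.
Proof.
  intros f0; rewrite gM_get, !get_frame; destruct i, j; simpl; field; auto.
Qed.

Lemma gD_frame (f : R -> R) (i j : leg) (p : M) : f (fst p) <> 0 ->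
  gD f p (frame f i p) (frame f j p) = delta i j.
Proof.
  intros f0; rewrite gD_get, !get_frame; destruct i, j; simpl; field; auto.
Qed.

Definition vert : M := (0, (0, 0, 1)).

Lemma gM_vert_frame (f : R -> R) (j : leg) (p : M) :
  gM f p vert (frame f j p) = 0.
Proof. rewrite gM_get, !get_frame; destruct j; simpl; ring. Qed.

(** The projection as a map on tangent vectors: the value of [piD f X] at [p]
    depends on [X p] only, which makes it linear over functions. *)
Definition projD (f : R -> R) (p u : M) : M := piD f (fun _ => u) p.

Lemma piD_projD (f : R -> R) (X : vfield) (p : M) : piD f X p = projD f p (X p).
Proof. reflexivity. Qed.

Lemma projD_expand (f : R -> R) (p u : M) :
  projD f p u =
  vadd (vadd (vscal (gM f p u (frame f legT p)) (frame f legT p))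
             (vscal (gM f p u (frame f leg1 p)) (frame f leg1 p)))
       (vscal (gM f p u (frame f leg2 p)) (frame f leg2 p)).
Proof. reflexivity. Qed.

Lemma projD_vadd (f : R -> R) (p u v : M) :
  projD f p (vadd u v) = vadd (projD f p u) (projD f p v).
Proof.
  rewrite !projD_expand, !gM_vadd_l.
  apply coords_ext; intros i; repeat rewrite ?get_vadd, ?get_vscal; ring.
Qed.

Lemma projD_vscal (f : R -> R) (p : M) (a : R) (u : M) :
  projD f p (vscal a u) = vscal a (projD f p u).
Proof.
  rewrite !projD_expand, !gM_vscal_l.
  apply coords_ext; intros i; repeat rewrite ?get_vadd, ?get_vscal; ring.
Qed.

Lemma projD_frame (f : R -> R) (l : leg) (p : M) :
  f (fst p) <> 0 -> projD f p (frame f l p) = frame f l p.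
Proof.
  intros f0; rewrite projD_expand, !gM_frame by assumption.
  apply coords_ext; intros i; repeat rewrite ?get_vadd, ?get_vscal; destruct l; simpl; ring.
Qed.

Lemma projD_vert (f : R -> R) (p : M) : projD f p vert = vscal 0 vert.
Proof.
  rewrite projD_expand, !gM_vert_frame.
  apply coords_ext; intros i; repeat rewrite ?get_vadd, ?get_vscal; ring.
Qed.

(** * Brackets of the frame and the Koszul formula *)

Definition rate (f : R -> R) (t : R) : R := Derive f t / f t.

Lemma ex_derive_rate (f : R -> R) (t : R) : smooth_R f -> f t <> 0 -> ex_derive (rate f) t.
Proof.
  intros fs f0; unfold rate.
  apply ex_derive_div; auto using smooth_R_ex_derive, smooth_R_Derive.
Qed.

Lemma deriv_inv_time (X : vfield) (f : R -> R) (p : M) : smooth_R f -> (forall t, f t <> 0) ->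
  deriv X (fun q => / f (fst q)) p = - get ct (X p) * rate f (fst p) * / f (fst p).
Proof.
  intros fs f0; rewrite (deriv_time X (fun t => / f t)).
  rewrite Derive_inv by auto using smooth_R_ex_derive.
  unfold rate; field; auto.
Qed.

Lemma deriv_frame (X : vfield) (f : R -> R) (l : leg) (i : coord) (p : M) :
  smooth_R f -> (forall t, f t <> 0) ->
  deriv X (fun q => get i (frame f l q)) p =
  - get ct (X p) * rate f (fst p) * match l with legT => 0 | _ => get i (frame f l p) end +
  match l, i with
  | leg1, cz => - / 2 * get cy (X p) * / f (fst p)
  | leg2, cz => / 2 * get cx (X p) * / f (fst p)
  | _, _ => 0
  end.
Proof.
  intros fs f0; rewrite get_frame, frame_coord; assert (s := smooth_inv_time f fs f0).
  destruct l, i;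
    repeat rewrite deriv_mult by (auto using smooth_const, smooth_coord, smooth_mult);
    rewrite ?deriv_const, ?deriv_coord, ?deriv_inv_time by assumption; ring.
Qed.

(** The bracket of two frame fields is [bracket_coef * f'/f] times the frame field
    [bracket_leg] plus [twist * f^-2] times the vertical field. *)
Definition bracket_coef (i j : leg) : R :=
  match i, j with
  | legT, leg1 | legT, leg2 => - 1 | leg1, legT | leg2, legT => 1 | _, _ => 0
  end.

Definition bracket_leg (i j : leg) : leg := match i with legT => j | _ => i end.

Definition twist (i j : leg) : R :=
  match i, j with leg1, leg2 => 1 | leg2, leg1 => - 1 | _, _ => 0 end.

Lemma bracket_frame (f : R -> R) (i j : leg) (p : M) :
  smooth_R f -> (forall t, f t <> 0) ->
  bracket (frame f i) (frame f j) p =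
  vadd (vscal (bracket_coef i j * rate f (fst p)) (frame f (bracket_leg i j) p))
       (vscal (twist i j * (/ f (fst p) * / f (fst p))) vert).
Proof.
  intros fs f0; apply coords_ext; intros k.
  unfold bracket; rewrite get_of_coords, !deriv_frame by assumption.
  rewrite get_vadd, !get_vscal.
  destruct i, j, k; rewrite !get_frame; simpl; lra.
Qed.

(** The three derivative terms of the general Koszul formula vanish, the inner
    products being constant. *)
Lemma koszul (f : R -> R) (nabla : vfield -> vfield -> vfield) (X Y Z : vfield) (p : M) :
  is_levi_civita (gM f) nabla ->
  smooth_vfield X -> smooth_vfield Y -> smooth_vfield Z ->
  (exists a b c, forall q, gM f q (X q) (Y q) = a /\ gM f q (X q) (Z q) = b /\
                           gM f q (Y q) (Z q) = c) ->
  2 * gM f p (nabla X Y p) (Z p) =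
  gM f p (bracket X Y p) (Z p) - gM f p (bracket X Z p) (Y p)
    - gM f p (bracket Y Z p) (X p).
Proof.
  intros [_ _ _ _ _ tor met] hX hY hZ [a [b [c e]]].
  rewrite <- !tor, !gM_vsub_l by assumption.
  assert (m1 := met X Y Z hX hY hZ p).
  assert (m2 := met Y X Z hY hX hZ p).
  assert (m3 := met Z X Y hZ hX hY p).
  replace (fun q => gM f q (Y q) (Z q)) with (fun _ : M => c) in m1
    by (extensionality q; symmetry; apply e).
  replace (fun q => gM f q (X q) (Z q)) with (fun _ : M => b) in m2
    by (extensionality q; symmetry; apply e).
  replace (fun q => gM f q (X q) (Y q)) with (fun _ : M => a) in m3
    by (extensionality q; symmetry; apply e).
  rewrite deriv_const in m1, m2, m3.
  rewrite (gM_sym f p (Y p)) in m1.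
  rewrite (gM_sym f p (X p)) in m2, m3.
  lra.
Qed.

(** * The projected connection and its curvature *)

(** The projected derivative of the frame field [j] along [i] is [conn_coef * f'/f]
    times the frame field [conn_leg]. *)
Definition conn_coef (i j : leg) : R :=
  match i, j with
  | leg1, legT | leg2, legT => 1
  | leg1, leg1 | leg2, leg2 => - 1
  | _, _ => 0
  end.

Definition conn_leg (i j : leg) : leg := match j with legT => i | _ => legT end.

Section Curvature.

Variables (f : R -> R) (nabla : vfield -> vfield -> vfield).
Hypotheses (fs : smooth_R f) (f0 : forall t, f t <> 0)
  (lc : is_levi_civita (gM f) nabla).

Lemma gM_nabla_frame (i j k : leg) (p : M) :
  gM f p (nabla (frame f i) (frame f j) p) (frame f k p) =
  conn_coef i j * delta (conn_leg i j) k * rate f (fst p).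
Proof.
  assert (h := koszul f nabla (frame f i) (frame f j) (frame f k) p lc
     (smooth_frame f i fs f0) (smooth_frame f j fs f0) (smooth_frame f k fs f0)).
  rewrite !bracket_frame, !gM_vadd_l, !gM_vscal_l, !gM_vert_frame, !gM_frame in h by auto.
  enough (2 * gM f p (nabla (frame f i) (frame f j) p) (frame f k p) =
    2 * (conn_coef i j * delta (conn_leg i j) k * rate f (fst p))) by lra.
  rewrite h; [destruct i, j, k; simpl; lra|].
  exists (delta i j), (delta i k), (delta j k); intros q; repeat split; now apply gM_frame.
Qed.

Lemma nablaD_frame (i j : leg) :
  nablaD f nabla (frame f i) (frame f j) =
  fun p => vscal (conn_coef i j * rate f (fst p)) (frame f (conn_leg i j) p).
Proof.
  extensionality p; unfold nablaD; rewrite piD_projD, projD_expand, !gM_nabla_frame.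
  apply coords_ext; intros k; repeat rewrite ?get_vadd, ?get_vscal.
  destruct i, j; simpl; ring.
Qed.

Lemma smooth_rate (c : R) : smooth (fun p => c * rate f (fst p)).
Proof.
  apply smooth_mult; [apply smooth_const|]; unfold rate, Rdiv.
  apply smooth_mult; [apply smooth_time, smooth_R_Derive, fs | now apply smooth_inv_time].
Qed.

Definition rate_along (i : leg) (t : R) : R :=
  match i with legT => Derive (rate f) t | _ => 0 end.

Lemma deriv_rate (i : leg) (c : R) (p : M) :
  deriv (frame f i) (fun q => c * rate f (fst q)) p = c * rate_along i (fst p).
Proof.
  rewrite (deriv_time (frame f i) (fun t => c * rate f t)), Derive_scal, get_frame.
  destruct i; simpl; ring.
Qed.

(** The frame is closed under [nablaD] up to multiples of [f'/f], so this rule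
    computes every second covariant derivative of the frame. *)
Lemma nablaD_scaled (i j : leg) (c : R) (p : M) :
  nablaD f nabla (frame f i) (fun q => vscal (c * rate f (fst q)) (frame f j q)) p =
  vadd (vscal (c * rate_along i (fst p)) (frame f j p))
       (vscal (c * conn_coef i j * rate f (fst p) ^ 2) (frame f (conn_leg i j) p)).
Proof.
  unfold nablaD; rewrite piD_projD, (lc_leibniz _ _ lc), projD_vadd, !projD_vscal, projD_frame
    by auto using smooth_rate, smooth_frame.
  rewrite deriv_rate, <- piD_projD; fold (nablaD f nabla (frame f i) (frame f j)).
  rewrite nablaD_frame.
  apply coords_ext; intros k; repeat rewrite ?get_vadd, ?get_vscal; ring.
Qed.

Lemma piD_bracket_frame (i j : leg) :
  piD f (bracket (frame f i) (frame f j)) =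
  fun p => vscal (bracket_coef i j * rate f (fst p)) (frame f (bracket_leg i j) p).
Proof.
  extensionality p; rewrite piD_projD, bracket_frame by auto.
  rewrite projD_vadd, !projD_vscal, projD_frame, projD_vert by auto.
  apply coords_ext; intros k; repeat rewrite ?get_vadd, ?get_vscal; ring.
Qed.

Lemma nablaD_bracket (i j k : leg) (p : M) :
  nablaD f nabla (piD f (bracket (frame f i) (frame f j))) (frame f k) p =
  vscal (bracket_coef i j * conn_coef (bracket_leg i j) k * rate f (fst p) ^ 2)
        (frame f (conn_leg (bracket_leg i j) k) p).
Proof.
  rewrite piD_bracket_frame; unfold nablaD.
  rewrite piD_projD, (lc_scal_l _ _ lc), projD_vscal, <- piD_projD
    by auto using smooth_rate, smooth_frame.
  fold (nablaD f nabla (frame f (bracket_leg i j)) (frame f k)); rewrite nablaD_frame.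
  apply coords_ext; intros l; repeat rewrite ?get_vadd, ?get_vscal; ring.
Qed.

Lemma piDperp_bracket_frame (i j : leg) :
  piDperp f (bracket (frame f i) (frame f j)) =
  fun p => vscal (twist i j * (/ f (fst p) * / f (fst p))) vert.
Proof.
  extensionality p; unfold piDperp; rewrite piD_bracket_frame, bracket_frame by auto.
  apply coords_ext; intros l; repeat rewrite ?get_vadd, ?get_vsub, ?get_vscal; ring.
Qed.

(** The frame coefficients do not depend on [z], so the flow of the vertical field
    preserves the frame, and the bracket with a multiple of that field only
    differentiates the factor: it stays vertical.  Hence the correction term of
    the curvature vanishes on the frame. *)
Lemma piD_bracket_vert (h : M -> R) (k : leg) (p : M) : smooth h ->
  piD f (bracket (fun q => vscal (h q) vert) (frame f k)) p = vscal 0 vert.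
Proof.
  intros hs; rewrite piD_projD.
  replace (bracket (fun q => vscal (h q) vert) (frame f k) p)
    with (vscal (- deriv (frame f k) h p) vert).
  - rewrite projD_vscal, projD_vert.
    apply coords_ext; intros l; rewrite !get_vscal; ring.
  - apply coords_ext; intros l; unfold bracket.
    rewrite get_of_coords, get_vscal, deriv_frame by auto.
    replace (fun q => get l (vscal (h q) vert)) with (fun q => h q * get l vert)
      by (extensionality q; now rewrite get_vscal).
    rewrite deriv_mult, deriv_const by auto using smooth_const.
    rewrite !get_vscal; destruct k, l; simpl; ring.
Qed.

(** With the sign convention of the Ricci tensor these are the summands of [RicD];
    [r' + r^2] is [f'' / f]. *)
Lemma curvD_frame (i j : leg) (p : M) :
  gD f p (curvD f nabla (frame f i) (frame f j) (frame f i) p) (frame f j p) =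
  match i, j with
  | legT, legT | leg1, leg1 | leg2, leg2 => 0
  | leg1, leg2 | leg2, leg1 => rate f (fst p) ^ 2
  | _, _ => Derive (rate f) (fst p) + rate f (fst p) ^ 2
  end.
Proof.
  unfold curvD; rewrite !nablaD_frame, !nablaD_scaled, nablaD_bracket.
  rewrite piDperp_bracket_frame, piD_bracket_vert
    by (repeat apply smooth_mult; auto using smooth_const, smooth_inv_time).
  rewrite !gD_vsub_l, !gD_vadd_l, !gD_vscal_l, !gD_frame by auto.
  replace (gD f p vert (frame f j p)) with 0
    by (rewrite gD_get; simpl; ring).
  destruct i, j; simpl; lra.
Qed.

Lemma scalar_curvD_warped (p : M) :
  scalar_curvD f nabla p =
  4 * Derive (rate f) (fst p) + 6 * rate f (fst p) ^ 2.
Proof.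
  unfold scalar_curvD, RicD.
  change ED1 with (frame f legT); change (ED2 f) with (frame f leg1);
    change (ED3 f) with (frame f leg2).
  rewrite !curvD_frame; ring.
Qed.

End Curvature.

(** * The linear equation w'' = k w *)

Lemma const_of_derive (u : R -> R) :
  (forall t, is_derive u t 0) -> forall t, u t = u 0.
Proof.
  intros hu t.
  destruct (MVT_gen u 0 t (fun _ => 0)) as [c [_ h]].
  - intros; apply hu.
  - intros x _; apply continuity_pt_filterlim, (ex_derive_continuous u); eexists; apply hu.
  - lra.
Qed.

Lemma ode_zero (w w' : R -> R) :
  (forall t, is_derive w t (w' t)) -> (forall t, is_derive w' t 0) ->
  forall t, w t = w' 0 * t + w 0.
Proof.
  intros hw hw' t.
  assert (c := const_of_derive w' hw').
  enough (w t - w' 0 * t = w 0 - w' 0 * 0) by lra.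
  apply (const_of_derive (fun s => w s - w' 0 * s)). intros s.
  assert (h := hw s); rewrite (c s) in h.
  auto_derive; [eexists; exact h|]. rewrite (is_derive_unique (fun x : R => w x) _ _ h); ring.
Qed.

(** For [b = a] and [b = - a], the operator [d/dt - b] annihilates [w' + b w], so
    [(w' + b w) exp (- b t)] is constant; the two constants determine [w]. *)
Lemma ode_exp (w w' : R -> R) (a : R) : a <> 0 ->
  (forall t, is_derive w t (w' t)) -> (forall t, is_derive w' t (a ^ 2 * w t)) ->
  exists c1 c2, forall t, w t = c1 * exp (a * t) + c2 * exp (- a * t).
Proof.
  intros ha hw hw'.
  exists ((w 0 + w' 0 / a) / 2), ((w 0 - w' 0 / a) / 2). intros t.
  assert (h : forall b, b ^ 2 = a ^ 2 -> (w' t + b * w t) * exp (- b * t) = w' 0 + b * w 0).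
  { intros b hb.
    replace (w' 0 + b * w 0) with ((w' 0 + b * w 0) * exp (- b * 0))
      by (replace (- b * 0) with 0 by ring; rewrite exp_0; ring).
    apply (const_of_derive (fun s => (w' s + b * w s) * exp (- b * s))). intros s.
    assert (h := hw s); assert (h' := hw' s).
    auto_derive; [repeat split; eexists; eassumption|].
    rewrite (is_derive_unique (fun x : R => w x) _ _ h),
      (is_derive_unique (fun x : R => w' x) _ _ h'), <- hb; ring. }
  assert (hp := h a eq_refl). assert (hm := h (- a) ltac:(ring)).
  replace (- - a * t) with (a * t) in hm by ring.
  assert (e : exp (a * t) * exp (- a * t) = 1).
  { rewrite <- exp_plus. replace (a * t + - a * t) with 0 by ring. apply exp_0. }
  replace ((w 0 + w' 0 / a) / 2) with ((w' 0 + a * w 0) / (2 * a)) by (field; auto).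
  replace ((w 0 - w' 0 / a) / 2) with (- (w' 0 + - a * w 0) / (2 * a)) by (field; auto).
  rewrite <- hp, <- hm.
  transitivity (w t * (exp (a * t) * exp (- a * t))); [rewrite e; ring | field; auto].
Qed.

(** The first integrals are the components of [(w, w' / a)] in a frame rotating
    with angular velocity [a]. *)
Lemma ode_trig (w w' : R -> R) (a : R) : a <> 0 ->
  (forall t, is_derive w t (w' t)) -> (forall t, is_derive w' t (- a ^ 2 * w t)) ->
  exists c1 c2, forall t, w t = c1 * cos (a * t) + c2 * sin (a * t).
Proof.
  intros ha hw hw'.
  exists (w 0), (w' 0 / a). intros t.
  assert (hc : w t * cos (a * t) - w' t / a * sin (a * t) = w 0).
  { transitivity (w 0 * cos (a * 0) - w' 0 / a * sin (a * 0));
      [|replace (a * 0) with 0 by ring; rewrite cos_0, sin_0; ring].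
    apply (const_of_derive (fun s => w s * cos (a * s) - w' s / a * sin (a * s))). intros s.
    assert (h := hw s); assert (h' := hw' s).
    auto_derive; [repeat split; eexists; eassumption|].
    rewrite (is_derive_unique (fun x : R => w x) _ _ h),
      (is_derive_unique (fun x : R => w' x) _ _ h'); field; auto. }
  assert (hs : w t * sin (a * t) + w' t / a * cos (a * t) = w' 0 / a).
  { transitivity (w 0 * sin (a * 0) + w' 0 / a * cos (a * 0));
      [|replace (a * 0) with 0 by ring; rewrite cos_0, sin_0; ring].
    apply (const_of_derive (fun s => w s * sin (a * s) + w' s / a * cos (a * s))). intros s.
    assert (h := hw s); assert (h' := hw' s).
    auto_derive; [repeat split; eexists; eassumption|].
    rewrite (is_derive_unique (fun x : R => w x) _ _ h),
      (is_derive_unique (fun x : R => w' x) _ _ h'); field; auto. }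
  assert (e := sin2_cos2 (a * t)); unfold Rsqr in e.
  rewrite <- hc, <- hs.
  transitivity (w t * (sin (a * t) * sin (a * t) + cos (a * t) * cos (a * t)));
    [rewrite e; ring | ring].
Qed.

(** * The power 2/3 *)

Lemma pow23_pos (w : R) : w <> 0 -> 0 < pow23 w.
Proof. intros hw; unfold pow23; destruct (Req_EM_T w 0); [easy | apply exp_pos]. Qed.

Lemma pow23_cube (w : R) : pow23 w ^ 3 = w ^ 2.
Proof.
  unfold pow23; destruct (Req_EM_T w 0) as [->|hw]; [ring|].
  rewrite <- Rpower_pow by apply exp_pos.
  rewrite Rpower_mult. replace (2 / 3 * INR 3) with (INR 2) by (simpl; lra).
  rewrite Rpower_pow by now apply Rabs_pos_lt.
  apply pow2_abs.
Qed.

Lemma pow23_unique (w y : R) : 0 < y -> y ^ 3 = w ^ 2 -> y = pow23 w.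
Proof.
  intros hy h.
  assert (hw : w <> 0) by (intros ->; assert (0 < y ^ 3) by (now apply pow_lt); lra).
  assert (hp := pow23_pos w hw). rewrite <- pow23_cube in h.
  assert (k : (y - pow23 w) * (y ^ 2 + y * pow23 w + pow23 w ^ 2) = 0) by lra.
  destruct (Rmult_integral _ _ k); nra.
Qed.

(** * The warping function and its profile *)

Lemma constant_sign (f : R -> R) : (forall t, continuous f t) -> (forall t, f t <> 0) ->
  exists sigma, (sigma = 1 \/ sigma = - 1) /\ forall t, 0 < sigma * f t.
Proof.
  intros fc f0.
  assert (h : forall t, 0 < f 0 * f t).
  { intros t; apply Rnot_le_lt; intros hle.
    destruct (IVT_gen f 0 t 0) as [x [_ hx]].
    - intros s; apply continuity_pt_filterlim, fc.
    - assert (a := f0 0); assert (b := f0 t).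
      unfold Rmin, Rmax; destruct (Rle_dec (f 0) (f t)); split; nra.
    - exact (f0 x hx). }
  destruct (Rtotal_order (f 0) 0) as [n|[z|p]]; [|now destruct (f0 0)|].
  - exists (- 1); split; [auto|]. intros t; assert (a := h t); nra.
  - exists 1; split; [auto|]. intros t; assert (a := h t); nra.
Qed.

(** Differentiating [f^3 = sigma w^2] and dividing by it gives
    [3 f' / f = 2 w' / w].  Stating the relation for the cube avoids differentiating
    [pow23], and makes the zeros of [w] those of [f]. *)
Lemma scalar_of_profile (f w w' : R -> R) (sigma k : R) :
  smooth_R f -> (forall t, f t <> 0) -> (forall t, f t ^ 3 = sigma * w t ^ 2) ->
  (forall t, is_derive w t (w' t)) -> (forall t, is_derive w' t (k * w t)) ->
  forall t, 4 * Derive (rate f) t + 6 * rate f t ^ 2 = 8 / 3 * k.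
Proof.
  intros fs f0 hfw hw hw'.
  assert (w0 : forall t, sigma * w t ^ 2 <> 0)
    by (intros t; rewrite <- hfw; now apply pow_nonzero).
  assert (w0' : forall t, w t <> 0) by (intros t e; apply (w0 t); rewrite e; ring).
  assert (hr : forall t, rate f t = 2 / 3 * (w' t / w t)).
  { intros t.
    assert (d : is_derive (fun s => f s ^ 3) t (3 * f t ^ 2 * Derive f t)).
    { assert (e := smooth_R_ex_derive f t fs). auto_derive; [exact e|].
      change (Derive (fun s : R => f s) t) with (Derive f t); ring. }
    apply (is_derive_ext _ (fun s => sigma * w s ^ 2)) in d; [|exact hfw].
    assert (d' : is_derive (fun s => sigma * w s ^ 2) t (sigma * (2 * w t * w' t))).
    { assert (h := hw t). auto_derive; [eexists; exact h|].
      rewrite (is_derive_unique (fun x : R => w x) _ _ h); ring. }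
    assert (e := is_derive_unique _ _ _ d); rewrite (is_derive_unique _ _ _ d') in e.
    assert (a := hfw t); assert (b := f0 t); assert (c := w0' t).
    unfold rate.
    apply (Rmult_eq_reg_r (3 * (sigma * w t ^ 2)));
      [|apply Rmult_integral_contrapositive; auto with real].
    rewrite <- a at 1.
    transitivity (3 * f t ^ 2 * Derive f t); [field; auto|].
    rewrite <- e; field; auto. }
  intros t.
  assert (d : is_derive (fun s => 2 / 3 * (w' s / w s)) t
                (2 / 3 * (k - (w' t / w t) ^ 2))).
  { assert (h := hw t); assert (h' := hw' t); assert (c := w0' t).
    auto_derive; [repeat split; try (eexists; eassumption); auto|].
    rewrite (is_derive_unique (fun x : R => w x) _ _ h),
      (is_derive_unique (fun x : R => w' x) _ _ h').
    field; auto. }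
  assert (e : Derive (rate f) t = 2 / 3 * (k - (w' t / w t) ^ 2))
    by (rewrite (Derive_ext _ _ _ hr); exact (is_derive_unique _ _ _ d)).
  rewrite e, hr; field; auto.
Qed.

(** The profile is [w = sqrt ((sigma f)^3)], which satisfies [w' = (3/2) (f'/f) w]. *)
Lemma profile_of_scalar (f : R -> R) (sigma k : R) :
  smooth_R f -> (forall t, f t <> 0) -> (sigma = 1 \/ sigma = - 1) ->
  (forall t, 0 < sigma * f t) ->
  (forall t, 4 * Derive (rate f) t + 6 * rate f t ^ 2 = 8 / 3 * k) ->
  exists w w' : R -> R,
    (forall t, is_derive w t (w' t)) /\ (forall t, is_derive w' t (k * w t)) /\
    forall t, f t = sigma * pow23 (w t).
Proof.
  intros fs f0 hs hpos hk.
  assert (hc : forall t, 0 < (sigma * f t) ^ 3) by (intros; now apply pow_lt).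
  set (w := fun t => sqrt ((sigma * f t) ^ 3)).
  assert (dw : forall t, is_derive w t (3 / 2 * rate f t * w t)).
  { intros t; unfold w.
    assert (e := smooth_R_ex_derive f t fs); assert (c := hc t).
    assert (q := sqrt_lt_R0 _ c). assert (s := sqrt_sqrt _ (Rlt_le _ _ c)).
    auto_derive; [split; [exact e | split; [exact c | exact I]]|].
    change (Derive (fun s : R => f s) t) with (Derive f t).
    cbn in q, s |- *.
    set (r := sqrt _) in *.
    apply (Rmult_eq_reg_r (2 * r * f t)); [|assert (a := f0 t); nra].
    transitivity (3 * (sigma * f t * (sigma * f t * (sigma * f t * 1))) * Derive f t);
      [field; lra|].
    rewrite <- s; unfold rate; field; auto. }
  exists w, (fun t => 3 / 2 * rate f t * w t); split; [exact dw|split].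
  - intros t. assert (h := dw t); assert (e := ex_derive_rate f t fs (f0 t)).
    auto_derive; [split; [exact e | split; [eexists; exact h | exact I]]|].
    rewrite (is_derive_unique (fun x : R => w x) _ _ h).
    change (Derive (fun s : R => rate f s) t) with (Derive (rate f) t).
    replace k with (3 / 8 * (8 / 3 * k)) by field.
    rewrite <- (hk t); field.
  - intros t.
    rewrite <- (pow23_unique (w t) (sigma * f t)).
    + destruct hs as [-> | ->]; ring.
    + apply hpos.
    + unfold w; rewrite pow2_sqrt; [reflexivity | apply Rlt_le, hc].
Qed.

Theorem theorem5p4 (f : R -> R) (nabla : vfield -> vfield -> vfield) (lambda0 : R)
  (f_smooth : smooth_R f) (f_nonzero : forall t, f t <> 0)
  (nabla_LC : is_levi_civita (gM f) nabla) :
  constant_scalar_curvature f nabla lambda0 <->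
  exists sigma c1 c2 : R, (sigma = 1 \/ sigma = - 1) /\
    ((lambda0 = 0 /\
      forall t, f t = sigma * pow23 (c2 * t + c1)) \/
     (lambda0 > 0 /\
      forall t, f t = sigma * pow23 (c1 * exp (sqrt (3 * lambda0 / 8) * t) +
                                     c2 * exp (- sqrt (3 * lambda0 / 8) * t))) \/
     (lambda0 < 0 /\
      forall t, f t = sigma * pow23 (c1 * cos (sqrt (- (3 * lambda0 / 8)) * t) +
                                     c2 * sin (sqrt (- (3 * lambda0 / 8)) * t)))).
Proof.
  assert (csc : constant_scalar_curvature f nabla lambda0 <->
    forall t, 4 * Derive (rate f) t + 6 * rate f t ^ 2 = 8 / 3 * (3 * lambda0 / 8)).
  { replace (8 / 3 * (3 * lambda0 / 8)) with lambda0 by field.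
    split; intros h.
    - intros t; rewrite <- (h (t, (0, 0, 0))).
      now rewrite (scalar_curvD_warped f nabla).
    - intros p; rewrite (scalar_curvD_warped f nabla); auto. }
  rewrite csc; split.
  - intros hk.
    destruct (constant_sign f) as [sigma [hs hpos]]; [|exact f_nonzero|].
    { intros t; now apply (ex_derive_continuous f), smooth_R_ex_derive. }
    destruct (profile_of_scalar f sigma (3 * lambda0 / 8)) as (w & w' & hw & hw' & hf); auto.
    exists sigma.
    destruct (Rtotal_order lambda0 0) as [n|[z|p]].
    + destruct (ode_trig w w' (sqrt (- (3 * lambda0 / 8)))) as (c1 & c2 & h).
      * apply Rgt_not_eq, sqrt_lt_R0; lra.
      * exact hw.
      * intros t; rewrite pow2_sqrt by lra.
        replace (- - (3 * lambda0 / 8)) with (3 * lambda0 / 8) by ring; apply hw'.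
      * exists c1, c2; split; [exact hs | right; right; split; [exact n|]].
        intros t; rewrite hf, h; reflexivity.
    + exists (w 0), (w' 0); split; [exact hs | left; split; [exact z|]].
      intros t; rewrite hf. rewrite (ode_zero w w'); [reflexivity | exact hw |].
      intros s; replace 0 with (3 * lambda0 / 8 * w s) by (rewrite z; field); apply hw'.
    + destruct (ode_exp w w' (sqrt (3 * lambda0 / 8))) as (c1 & c2 & h).
      * apply Rgt_not_eq, sqrt_lt_R0; lra.
      * exact hw.
      * intros t; rewrite pow2_sqrt by lra; apply hw'.
      * exists c1, c2; split; [exact hs | right; left; split; [exact p|]].
        intros t; rewrite hf, h; reflexivity.
  - intros (sigma & c1 & c2 & hs & h).
    assert (cube : forall w : R -> R, (forall t, f t = sigma * pow23 (w t)) ->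
              forall t, f t ^ 3 = sigma * w t ^ 2).
    { intros w hf t; rewrite hf, Rpow_mult_distr, pow23_cube.
      destruct hs as [-> | ->]; ring. }
    destruct h as [[z hf]|[[p hf]|[n hf]]]; pose proof (cube _ hf) as hc.
    + apply (scalar_of_profile f _ (fun _ => c2) sigma _ f_smooth f_nonzero hc).
      * intros t; auto_derive; [exact I | ring].
      * intros t; auto_derive; [exact I | rewrite z; field].
    + set (a := sqrt (3 * lambda0 / 8)) in *.
      assert (ha : a * a = 3 * lambda0 / 8) by (apply sqrt_sqrt; lra).
      rewrite <- ha.
      apply (scalar_of_profile f _
        (fun t => a * (c1 * exp (a * t) - c2 * exp (- a * t))) sigma _ f_smooth f_nonzero hc);
        intros t; (auto_derive; [exact I | ring]).
    + set (a := sqrt (- (3 * lambda0 / 8))) in *.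
      assert (ha : a * a = - (3 * lambda0 / 8)) by (apply sqrt_sqrt; lra).
      replace (3 * lambda0 / 8) with (- (a * a)) by lra.
      apply (scalar_of_profile f _
        (fun t => a * (c2 * cos (a * t) - c1 * sin (a * t))) sigma _ f_smooth f_nonzero hc);
        intros t; (auto_derive; [exact I | ring]).
Qed.
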